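(* Let $A$ be a matrix, finite or infinite, with entries from $\mathbb Q$. (a) If $A$ is image partition regular, then $I(A)$ is a left ideal of $(\beta\mathbb N,\cdot)$. (b) If $A$ is a finite image partition regular matrix, then $I(A)$ is a two-sided ideal of $(\beta\mathbb N,\cdot)$.
   Context: $\mathbb N=\{1,2,3,\dots\}$, $\omega=\{0,1,2,\dots\}$. Matrices are $u\times v$ with $u,v\in\mathbb N\cup\{\omega\}$, and each row has only finitely many nonzero entries (so that $A\vec x$ is defined); the matrix is finite if $u,v\in\mathbb N$. $A$ is image partition regular if whenever $\mathbb N$ is finitely colored there is a vector $\vec x$ with entries from $\mathbb N$ such that all entries of $A\vec x$ lie in one color class. $\beta\mathbb N$ is the set of ultrafilters on $\mathbb N$, with multiplication given by: $U\in p\cdot q$ iff $\{x\in\mathbb N: x^{-1}U\in q\}\in p$, where $x^{-1}U=\{y\in\mathbb N: xy\in U\}$. $I(A)=\{p\in\beta\mathbb N:$ for every $P\in p$ there exists $\vec x$ with entries from $\mathbb N$ such that all entries of $A\vec x$ are in $P\}$. A nonempty subset $I$ of a semigroup $(T,\cdot)$ is a left ideal if $T\cdot I\subseteq I$, a right ideal if $I\cdot T\subseteq I$, and a two-sided ideal if it is both. *)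

(* Defs.v *)
From HB Require Import structures.
From mathcomp Require Import all_boot all_order all_algebra.
From mathcomp Require Import all_classical.
Set Implicit Arguments.
Unset Strict Implicit.
Unset Printing Implicit Defensive.

Import GRing.Theory.
Local Open Scope classical_set_scope.

(* The multiplicative semigroup of positive natural numbers, {1, 2, 3, ...}. *)
Record npos := NPos { npos_val :> nat; npos_gt0 : (0 < npos_val)%N }.
HB.instance Definition _ := [isSub for npos_val].
HB.instance Definition _ := [Choice of npos by <:].

Lemma npos_mul_subproof (m n : npos) : (0 < m * n)%N.
Proof. by rewrite muln_gt0 !npos_gt0. Qed.

Definition npos_mul (m n : npos) : npos := NPos (npos_mul_subproof m n).

Lemma npos_mulA : associative npos_mul.
Proof. by move=> m n k; apply: val_inj; rewrite /= mulnA. Qed.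

HB.instance Definition _ := isSemigroup.Build npos npos_mulA.

Section StoneCech.

Record beta (T : Type) := Beta {
  beta_sets :> set T -> Prop;
  beta_ultra : UltraFilter beta_sets }.

HB.instance Definition _ (T : Type) := gen_eqMixin (beta T).
HB.instance Definition _ (T : Type) := gen_choiceMixin (beta T).

Lemma beta_inj (T : Type) (p q : beta T) :
  (forall U, p U <-> q U) -> p = q.
Proof.
case: p q => [p up] [q uq] /= pq.
have epq : p = q by apply/funext => U; apply/propext.
by case: _ / epq uq => uq; congr Beta; exact: Prop_irrelevance.
Qed.

Variable T : semigroupType.

Definition beta_mul_sets (p q : beta T) : set T -> Prop :=
  fun U => p [set x | q [set y | U (x * y)%g]].

Lemma beta_mul_ultra (p q : beta T) : UltraFilter (beta_mul_sets p q).
Proof.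
have up := beta_ultra p; have uq := beta_ultra q.
have PF : ProperFilter (beta_mul_sets p q).
  rewrite /beta_mul_sets; split; [|split].
  - move=> p0; apply: (@filter_not_empty _ p).
    by apply: filterS p0 => x /= /filter_not_empty.
  - by apply: (@filterS _ p _ setT) => [x _ /=|]; exact: filterT.
  - move=> U V pU pV.
    apply: (@filterS _ p _ _ _ _ (@filterI _ p _ _ _ pU pV)) => x [/= qU qV].
    exact: (@filterI _ q _ (fun y => U _) (fun y => V _)).
  - move=> U V UV; apply: (@filterS _ p) => x /=.
    by apply: (@filterS _ q) => y; exact: UV.
split=> // G PG sG; apply/seteqP; split=> // U GU.
have [//|pnU] := in_ultra_setVsetC [set x | q [set y | U (x * y)%g]] up.
exfalso; apply: (@filter_not_empty _ G).
suff GnU : G (~` U) by apply: filterS (filterI GU GnU) => x [].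
apply: sG; rewrite /beta_mul_sets; apply: filterS pnU => x /= nq.
by have [/nq|] := in_ultra_setVsetC [set y | U (x * y)%g] uq.
Qed.

Definition beta_mul (p q : beta T) : beta T := Beta (beta_mul_ultra p q).

Lemma beta_mulA : associative beta_mul.
Proof.
move=> p q r; apply: beta_inj => U; rewrite /= /beta_mul_sets /=.
suff -> : [set x | q [set y | r [set z | U (x * (y * z))%g]]] =
          [set x | q [set y | r [set z | U (x * y * z)%g]]] by [].
apply/funext => x /=; congr (beta_sets q _); apply/funext => y /=.
by congr (beta_sets r _); apply/funext => z /=; rewrite mulgA.
Qed.

HB.instance Definition _ := isSemigroup.Build (beta T) beta_mulA.

End StoneCech.

Section Ideals.
Variable T : semigroupType.

Definition left_ideal (I : set T) : Prop :=
  I !=set0 /\ forall t x : T, I x -> I (t * x)%g.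

Definition right_ideal (I : set T) : Prop :=
  I !=set0 /\ forall t x : T, I x -> I (x * t)%g.

Definition two_sided_ideal (I : set T) : Prop :=
  left_ideal I /\ right_ideal I.

End Ideals.

(* [Some n] is the dimension n >= 1, and [None] is the dimension omega. *)
Definition mx_dim := option npos.

Definition dim_index (d : mx_dim) : choiceType :=
  if d is Some n then 'I_n else nat.

Definition matrixQ (u v : mx_dim) := dim_index u -> dim_index v -> rat.

Definition finite_matrix (u v : mx_dim) (A : matrixQ u v) : Prop :=
  u <> None /\ v <> None.

Definition row_finite (u v : mx_dim) (A : matrixQ u v) : Prop :=
  forall i, finite_set [set j | A i j != 0%R].

Section ImagePartition.
Variables (u v : mx_dim) (A : matrixQ u v).

(* The sum ranges over the indices of nonzero terms; it is the usual A x when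
   A is row-finite. *)
Definition mulmxv (x : dim_index v -> npos) (i : dim_index u) : rat :=
  (\sum_(j \in [set: dim_index v]) A i j * (x j : nat)%:R)%R.

Definition entries_in (x : dim_index v -> npos) (P : set npos) : Prop :=
  forall i, exists2 n : npos, P n & mulmxv x i = ((n : nat)%:R)%R.

Definition image_partition_regular : Prop :=
  forall (k : nat) (c : npos -> 'I_k),
    exists (a : 'I_k) (x : dim_index v -> npos), entries_in x [set n | c n = a].

Definition I_of : set (beta npos) :=
  [set p : beta npos | forall P : set npos, p P -> exists x, entries_in x P].

End ImagePartition.

(* Main.v *)
Require Import Defs.
From mathcomp Require Import all_boot all_order all_algebra.
From mathcomp Require Import all_classical.

(** Call a set bad if it contains no image of [A]. If [A] is image partition
    regular, no finite union of bad sets is everything, so some ultrafilter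
    contains no bad set and [I_of A] is nonempty. Closure under multiplication
    rests on [A (a x) = a (A x)]: for [q * p], a single multiplier [a] is chosen
    in a member of [q]; for [p * q], one multiplier must serve all the entries of
    [A x] simultaneously, which is possible when there are finitely many rows. *)

Import GRing.Theory.
Local Open Scope classical_set_scope.

Lemma mulmxv_scale (u v : mx_dim) (A : matrixQ u v) (a : npos)
    (x : dim_index v -> npos) (i : dim_index u) :
  row_finite A ->
  mulmxv A (fun j => npos_mul a (x j)) i = ((a : nat)%:R * mulmxv A x i)%R.
Proof.
move=> /(_ i) finA.
(* The nonzero positions of row [i] form a finite set independent of the vector, so both sides
   become ordinary sums over the same indices. *)
have restrict (z : dim_index v -> npos) :
    mulmxv A z i = (\sum_(j \in [set j | A i j != 0]) A i j * (z j : nat)%:R)%R.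
  apply/esym/fsbig_widen => // j [_ /negP].
  by rewrite negbK => /eqP /= ->; rewrite mul0r.
rewrite !restrict !fsbig_finite //= mulr_sumr; apply: eq_bigr => j _.
by rewrite natrM mulrCA.
Qed.

Lemma entries_in_scale (u v : mx_dim) (A : matrixQ u v) (a : npos)
    (x : dim_index v -> npos) (P : set npos) :
  row_finite A -> entries_in A x [set y | P (npos_mul a y)] ->
  entries_in A (fun j => npos_mul a (x j)) P.
Proof.
move=> rfA xP i; have [n Pn xn] := xP i.
by exists (npos_mul a n) => //; rewrite mulmxv_scale// xn -natrM.
Qed.

Lemma entries_in_subset (u v : mx_dim) (A : matrixQ u v)
    (x : dim_index v -> npos) (P Q : set npos) :
  P `<=` Q -> entries_in A x P -> entries_in A x Q.
Proof. by move=> PQ xP i; have [n /PQ] := xP i; exists n. Qed.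

(** The filter generated by the complements of bad sets. With arbitrary finite index types,
    intersecting two members amounts to forming [J + K]. *)
Definition cofinite_bad (T : Type) (bad : set T -> Prop) : set_system T :=
  [set U | exists (J : finType) (B : J -> set T),
     (forall j, bad (B j)) /\ ~` U `<=` \bigcup_j B j].

Lemma cofinite_bad_filter (T : Type) (bad : set T -> Prop) :
  Filter (cofinite_bad T bad).
Proof.
split.
- exists void, (fun=> set0); split; first by case.
  by rewrite setCT; exact: sub0set.
- move=> U V [J [B [badB UB]]] [K [C [badC VC]]].
  exists (J + K)%type, (fun s => match s with inl j => B j | inr k => C k end).
  split; first by case.
  rewrite setCI => t [/UB [j _ Bt]|/VC [k _ Ct]]; first by exists (inl j).
  by exists (inr k).
- move=> U V UV [J [B [badB UB]]]; exists J, B; split=> //.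
  by apply: subset_trans UB; exact: subsetC.
Qed.

Lemma I_of_nonempty (u v : mx_dim) (A : matrixQ u v) :
  image_partition_regular A -> I_of A !=set0.
Proof.
move=> ipr; pose bad P := ~ exists x, entries_in A x P.
have filt := cofinite_bad_filter npos bad.
have proper : ProperFilter (cofinite_bad npos bad).
  split=> //; case=> J [B [badB]]; rewrite setC0 => cover.
  (* Colour [n] by the index of a bad set containing it; a monochromatic image of [A] then lies in a
     single bad set, a contradiction. *)
  have /choice [c cB] n : exists j, B j n by have [j _] := cover n I; exists j.
  have [a [x xa]] := ipr _ (fun n => enum_rank (c n)).
  apply: (badB (enum_val a)); exists x.
  by apply: entries_in_subset xa => n /= <-; rewrite enum_rankK.
have [p [up sub_p]] := ultraFilterLemma proper.
exists (Beta up) => P /= pP; apply: contrapT => badP.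
have pCP : p (~` P).
  apply: sub_p; exists unit, (fun=> P); split=> //.
  by rewrite setCK => t Pt; exists tt.
apply: (@filter_not_empty _ p).
by apply: filterS (filterI pP pCP) => t [].
Qed.

Lemma I_of_mull (u v : mx_dim) (A : matrixQ u v) (q p : beta npos) :
  row_finite A -> I_of A p -> I_of A (q * p)%g.
Proof.
move=> rfA Ip P qpP; have uq := beta_ultra q.
(* Some [a] has its quotient set [a^{-1}P] in [p], and that set contains an image of [A]. *)
have [a /= /Ip [x xP]] := filter_ex (F := q) qpP.
by exists (fun j => npos_mul a (x j)); exact: entries_in_scale.
Qed.

Lemma I_of_mulr (n : npos) (v : mx_dim) (A : matrixQ (Some n) v)
    (p q : beta npos) :
  row_finite A -> I_of A p -> I_of A (p * q)%g.
Proof.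
move=> rfA Ip P /Ip [x xP]; have uq := beta_ultra q.
have /choice [m mP] (i : 'I_n) : exists m : npos,
    q [set y | P (m * y)%g] /\ mulmxv A x i = (m : nat)%:R%R.
  by have [m] := xP i; exists m.
(* The quotients of [P] by the entries [m i] are finitely many members of [q], so they have a common
   point [y]. *)
have [y yP] : exists y, forall i, P (m i * y)%g.
  apply: (filter_ex (F := q)); apply: filter_forall => i.
  by have [] := mP i.
exists (fun j => npos_mul y (x j)); apply: entries_in_scale => // i.
have [_ xm] := mP i; exists (m i) => //=.
(* Scaling puts [y] on the left, the product [p * q] puts it on the right; commutativity reconciles
   them. *)
suff -> : npos_mul y (m i) = (m i * y)%g by [].
by apply: val_inj; rewrite /= mulnC.
Qed.

Theorem lemma2p3 (u v : mx_dim) (A : matrixQ u v) (rfA : row_finite A) :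
  (image_partition_regular A -> left_ideal (I_of A)) /\
  (finite_matrix A -> image_partition_regular A -> two_sided_ideal (I_of A)).
Proof.
have left : image_partition_regular A -> left_ideal (I_of A).
  move=> ipr; split; first exact: I_of_nonempty.
  by move=> q p; exact: I_of_mull.
split=> // -[u_fin _] ipr; split; first exact: left.
split; first exact: I_of_nonempty.
case: u A rfA u_fin {left ipr} => [n|] A rfA // _ q p.
exact: I_of_mulr.
Qed.
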